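(* Let $b \in \mathbb{C}$. The variety $\mathcal{M}_b = \mathrm{Spec}\big(\mathbb{C}[x_1,x_2,x_3]/(t-b)\big)$, where $t = -2 + x_1^2 + x_2^2 + x_3^2 - x_1x_2x_3$, is singular if and only if $\psi_1(b) = 0$, where $\psi_1(y) = y^2 - 4$.
   Context: $\mathcal{M}_b$ is the relative $\mathrm{SL}(2,\mathbb{C})$-representation variety of the one-holed torus: its fundamental group is the free group $\langle F_1,F_2\rangle$, the trace coordinates of a representation $\rho$ are $x_1=\mathrm{tr}\,\rho(F_1)$, $x_2=\mathrm{tr}\,\rho(F_2)$, $x_3=\mathrm{tr}\,\rho(F_1F_2)$, and $t$ is the trace of $\rho(F_1F_2F_1^{-1}F_2^{-1})$ (the boundary element). For an ideal $I=(\phi_1,\dots,\phi_k)\subseteq \mathcal{O}=\mathbb{C}[x_1,\dots,x_n]$ of codimension $c$, $\mathrm{Spec}(\mathcal{O}/I)$ is smooth if and only if its Jacobian ideal, i.e. $I$ plus the ideal generated by the $c\times c$ minors of $[\partial\phi_i/\partial x_j]$, equals $\mathcal{O}$; singular means not smooth. *)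

(* Defs.v *)
From HB Require Import structures.
From mathcomp Require Import all_boot all_order all_algebra.
From mathcomp Require Import ring_quotient reals complex mpoly.

Set Implicit Arguments.
Unset Strict Implicit.
Unset Printing Implicit Defensive.

Import GRing.Theory.
Local Open Scope ring_scope.

Section Ideals.
Variable A : comNzRingType.

Definition ideal_gen (s : seq A) (f : A) : Prop :=
  exists a : 'I_(size s) -> A, f = \sum_i a i * s`_i.

Definition prime_ideal (P : {pred A}) : Prop :=
  idealr_closed P /\ prime_idealr_closed P.

(* There is a chain P_0 < P_1 < ... < P_c = P of prime ideals. *)
Definition height_ge (c : nat) (P : {pred A}) : Prop :=
  exists Q : 'I_c.+1 -> {pred A},
    [/\ forall i, prime_ideal (Q i),
        forall i j : 'I_c.+1, (i < j)%N ->
          {subset Q i <= Q j} /\ ~ {subset Q j <= Q i}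
      & Q ord_max =i P].

Definition prime_over (I : A -> Prop) (P : {pred A}) : Prop :=
  prime_ideal P /\ (forall f, I f -> f \in P).

(* The codimension (height) of I is the least height of a prime ideal
   containing I.  The unit ideal has no codimension in this sense. *)
Definition has_codim (I : A -> Prop) (c : nat) : Prop :=
  (forall P, prime_over I P -> height_ge c P) /\
  (exists P, prime_over I P /\ ~ height_ge c.+1 P).

End Ideals.

Section Smoothness.
Variables (C : fieldType) (n k : nat) (phi : k.-tuple {mpoly C[n]}).

Definition jacobian_mx : 'M[{mpoly C[n]}]_(k, n) :=
  \matrix_(i < k, j < n) (tnth phi i)^`M(j).

(* Rows and columns are selected by arbitrary maps; compared with increasing
   selections this only adds zeros and sign changes of minors, which does not
   affect the ideal they generate. *)
Definition jacobian_minors (c : nat) : seq {mpoly C[n]} :=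
  [seq \det (mxsub r s jacobian_mx)
     | r : {ffun 'I_c -> 'I_k} <- enum {ffun 'I_c -> 'I_k},
       s : {ffun 'I_c -> 'I_n} <- enum {ffun 'I_c -> 'I_n}].

Definition jacobian_ideal (c : nat) : {mpoly C[n]} -> Prop :=
  ideal_gen (phi ++ jacobian_minors c).

(* Smoothness of Spec (C[x_1, ..., x_n] / (phi_1, ..., phi_k)).  A proper ideal
   has exactly one codimension c; for the unit ideal the spectrum is empty,
   and the condition holds vacuously. *)
Definition smooth_Spec : Prop :=
  forall c, has_codim (ideal_gen phi) c -> forall f, jacobian_ideal c f.

Definition singular_Spec : Prop := ~ smooth_Spec.

End Smoothness.

Section OneHoledTorus.
Variable C : fieldType.

Definition x1 : {mpoly C[3]} := 'X_(@Ordinal 3 0 isT).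
Definition x2 : {mpoly C[3]} := 'X_(@Ordinal 3 1 isT).
Definition x3 : {mpoly C[3]} := 'X_(@Ordinal 3 2 isT).

Definition boundary_trace : {mpoly C[3]} :=
  - 2%:R + x1 ^+ 2 + x2 ^+ 2 + x3 ^+ 2 - x1 * x2 * x3.

(* The equation t - b defining M_b in affine 3-space. *)
Definition M_eqn (b : C) : 1.-tuple {mpoly C[3]} :=
  [tuple boundary_trace - b%:MP].

Definition psi1 : {poly C} := 'X ^+ 2 - 4%:R.

End OneHoledTorus.

(* Main.v *)
From HB Require Import structures.
Require Import Defs.
From mathcomp Require Import all_boot all_order all_algebra.
From mathcomp Require Import reals complex mpoly.
From mathcomp Require Import ring_quotient boolp ring.

(** Put g := t - b.

    Smoothness is tested on the minors whose size is the codimension of (g),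
    so that codimension has to be determined: it is 1 for every b
    ([has_codim_M_eqn]).  In a polynomial ring a nonzero principal prime
    has height exactly 1 ([has_codim_principal_prime]), and (g) is prime
    ([prime_M_poly]): read in C[x_1][x_2][x_3], g is the monic quadratic
    x_3^2 - (x_1 x_2) x_3 + (x_1^2 + x_2^2 - 2 - b), whose discriminant
    (x_1^2 - 4) x_2^2 + ... is not a square of fractions, because its leading
    coefficient in x_2 vanishes to odd order at x_1 = 2.  A monic quadratic
    whose norm form is anisotropic generates a prime ideal
    ([prime_quadratic]).

    The Jacobian ideal is therefore J = (g, dg/dx_1, dg/dx_2, dg/dx_3).  Modulo
    J, each 2 x_i^2 equals x_1 x_2 x_3, and g = 0 then gives x_i^2 = b + 2 and
    x_1 x_2 x_3 = 2 (b + 2).  Comparing (x_1 x_2 x_3)^2 computed in both ways,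
    (b + 2)^2 (b - 2) lies in J, up to a factor 8
    ([jacobian_M_eqn_disc]); so J is the unit ideal unless b = 2 or b = -2.
    In these two cases g and its gradient vanish at (2, 2, 2), respectively at
    the origin, so J is proper ([jacobian_M_eqn_diag]). *)

Set Implicit Arguments.
Unset Strict Implicit.
Unset Printing Implicit Defensive.

Import GRing.Theory.
Local Open Scope ring_scope.

(** * Generated and principal ideals *)

Section IdealGen.
Variable A : comNzRingType.
Implicit Types (s : seq A) (f g p : A).

Lemma mem_ideal_gen s g : g \in s -> ideal_gen s g.
Proof.
move=> gs; have gi : (index g s < size s)%N by rewrite index_mem.
exists (fun i => (i == Ordinal gi)%:R).
rewrite (bigD1 (Ordinal gi)) //= eqxx mul1r nth_index // big1 ?addr0 // => i.
by move=> /negPf ->; rewrite mul0r.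
Qed.

Lemma ideal_genD s f g : ideal_gen s f -> ideal_gen s g -> ideal_gen s (f + g).
Proof.
move=> [a ->] [b ->]; exists (fun i => a i + b i).
by rewrite -big_split; apply: eq_bigr => i _; rewrite mulrDl.
Qed.

Lemma ideal_genM s a f : ideal_gen s f -> ideal_gen s (a * f).
Proof.
move=> [c ->]; exists (fun i => a * c i).
by rewrite mulr_sumr; apply: eq_bigr => i _; rewrite mulrA.
Qed.

Lemma ideal_gen_rmorph (B : comNzRingType) (h : {rmorphism A -> B}) s f :
  {in s, forall g, h g = 0} -> ideal_gen s f -> h f = 0.
Proof.
move=> h0 [a ->]; rewrite rmorph_sum big1 // => i _.
by rewrite rmorphM (h0 _ (mem_nth _ (ltn_ord i))) mulr0.
Qed.

Lemma ideal_gen1P p f : ideal_gen [:: p] f <-> exists h, f = h * p.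
Proof.
split=> [[a ->]|[h ->]]; first by exists (a ord0); rewrite big_ord1.
by apply/ideal_genM/mem_ideal_gen; rewrite inE.
Qed.

(** Prime ideals are boolean predicates, hence the classical truth value. *)
Definition principal p : {pred A} := [pred f | `[< exists h, f = h * p >]].

Lemma principalP p f : reflect (exists h, f = h * p) (f \in principal p).
Proof. exact: asboolP. Qed.

Lemma principalMl p h : h * p \in principal p.
Proof. by apply/principalP; exists h. Qed.

Lemma principal_idealr_closed p :
  1 \notin principal p -> idealr_closed (principal p).
Proof.
move=> n1; split=> // [|a f g /principalP[u ->] /principalP[v ->]].
  by rewrite -(mul0r p) principalMl.
by rewrite mulrA -mulrDl principalMl.
Qed.

End IdealGen.

(** * Height and codimension *)

Section Height.
Variable A : comNzRingType.

Lemma height_geW (c d : nat) (P : {pred A}) :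
  (c <= d)%N -> height_ge d P -> height_ge c P.
Proof.
move=> cd [Q [Qprime Qlt QP]].
(* Keep the last c + 1 members, so that the chain still ends at P. *)
have ub (i : 'I_c.+1) : (d - c + i < d.+1)%N.
  by rewrite ltnS -[leqRHS](subnK cd) leq_add2l -ltnS.
exists (fun i => Q (Ordinal (ub i))); split=> [i|i j ij|f]; first exact: Qprime.
  by apply: Qlt; rewrite /= ltn_add2l.
by rewrite -QP; congr (_ \in Q _); apply/val_inj; rewrite /= subnK.
Qed.

Lemma has_codim_unique (I : A -> Prop) (c d : nat) :
  has_codim I c -> has_codim I d -> c = d.
Proof.
have le a b : has_codim I a -> has_codim I b -> (a <= b)%N.
  move=> [ha _] [_ [P [IP nb]]]; rewrite leqNgt; apply/negP => ba.
  exact/nb/(height_geW ba)/ha.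
by move=> hc hd; apply/eqP; rewrite eqn_leq !le.
Qed.

End Height.

(** With psi a left inverse of phi, an equation phi f = h * phi p is carried
    back to f = psi h * p, so (p) is the preimage of (phi p).  This lets
    primality be tested in another ring in which division is available. *)
Lemma prime_principal_retract (A B : comNzRingType) (phi : {rmorphism A -> B})
    (psi : {rmorphism B -> A}) (p : A) :
  cancel phi psi -> prime_ideal (principal (phi p)) ->
  prime_ideal (principal p).
Proof.
move=> phiK [[_ n1 _] pr].
have phi_mem f : (phi f \in principal (phi p)) = (f \in principal p).
  apply/principalP/principalP => -[h e].
    by exists (psi h); rewrite -[f]phiK e rmorphM phiK.
  by exists (phi h); rewrite e rmorphM.
split; first by apply: principal_idealr_closed; rewrite -phi_mem rmorph1.
by move=> f g; rewrite -!phi_mem rmorphM; apply: pr.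
Qed.

Section PrincipalPrime.
Variables (K : fieldType) (n : nat) (p : {mpoly K[n]}).
Hypotheses (p0 : p != 0) (p_prime : prime_ideal (principal p)).

Lemma msize_prime_gt1 : (1 < msize p)%N.
Proof.
have [[_ n1 _] _] := p_prime.
rewrite ltnNge; apply: contra n1 => /msize1_polyC; set c := p@_0%MM => pc.
have c0 : c != 0 by apply: contraNneq p0 => c0; rewrite pc c0 mpolyC0.
by apply/principalP; exists c^-1%:MP; rewrite pc -mpolyCM mulVf.
Qed.

(** This gives height at most 1: any f in Q is h * p, and then h lies in Q
    since p does not; the degree drops at each such division, so the descent
    can only end at 0. *)
Lemma prime_below_principal (Q : {pred {mpoly K[n]}}) :
  prime_ideal Q -> {subset Q <= principal p} -> p \notin Q ->
  forall f, f \in Q -> f = 0.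
Proof.
move=> [_ Qprime] sub pQ f; have [m] := ubnP (msize f).
elim: m f => // m IH f fm fQ; apply/eqP; apply: contraT => f0.
have /principalP[h fE] := sub f fQ.
have h0 : h != 0 by apply: contraNneq f0 => h0; rewrite fE h0 mul0r.
suff hz : h = 0 by rewrite hz eqxx in h0.
apply: IH; last by move: fQ; rewrite fE => /Qprime; rewrite (negPf pQ) orbF.
move: fm; rewrite fE msizeM //.
case: (msize p) msize_prime_gt1 => [|[|k]] // _; rewrite !addnS /= ltnS.
by apply: leq_trans; rewrite ltnS leq_addr.
Qed.

(** The zero ideal lies strictly below every prime containing p, so every such
    prime has height at least 1, while (p) itself has no longer chain. *)
Lemma has_codim_principal_prime : has_codim (ideal_gen [:: p]) 1.
Proof.
split=> [P [[Pid Ppr] pP]|].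
  have pinP : p \in P by apply: pP; apply: mem_ideal_gen; rewrite inE.
  exists (fun i => if i == ord0 then [pred f | f == 0] : {pred _} else P); split=> //.
  - move=> i; case: eqP => _ //; split; first split.
    + exact: eqxx.
    + exact: oner_neq0.
    + by move=> a u v /eqP-> /eqP->; rewrite inE mulr0 addr0.
    + by move=> u v; rewrite !inE mulf_eq0.
  - move=> i j ij; have -> : i = ord0.
      by apply/val_inj; case: i j ij => [[|[|i]] hi] [[|[|j]] hj].
    have -> : (j == ord0) = false by case: j ij => [[|j] hj].
    rewrite eqxx; split=> [x /eqP ->|/(_ _ pinP)/eqP /eqP]; last exact/negP.
    by case: Pid.
exists (principal p); split; first by split=> // f /ideal_gen1P/principalP.
move=> [Q [Qprime Qlt QP]].
pose o0 : 'I_3 := ord0; pose o1 : 'I_3 := inord 1.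
have v1 : o1 = 1%N :> nat by rewrite inordK.
have [s01 n01] := Qlt o0 o1 ltac:(by rewrite v1).
have [s12 n12] := Qlt o1 ord_max ltac:(by rewrite v1).
have sub : {subset Q o1 <= principal p} by move=> f /s12; rewrite QP.
have zero f : f \in Q o1 -> f = 0.
  apply: prime_below_principal => //; apply/negP => pQ; apply: n12 => g.
  rewrite QP => /principalP[h ->]; have [[Q0 _ Qid] _] := Qprime o1.
  by rewrite -[_ * _]addr0; apply: Qid.
by apply: n01 => f /zero ->; have [[]] := Qprime o0.
Qed.

End PrincipalPrime.

(** * Primality of monic quadratics *)

Section Quadratic.
Variables (D : idomainType) (P Q : D).

Definition quadratic : {poly D} := 'X^2 - P *: 'X + Q%:P.

(* The form is the norm of u + v x, for x a root of the quadratic. *)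
Hypothesis norm_aniso :
  forall u v : D, u ^+ 2 + P * u * v + Q * v ^+ 2 = 0 -> v = 0.

Lemma size_quadratic : size quadratic = 3%N.
Proof.
rewrite /quadratic -addrA size_polyDl ?size_polyXn //.
rewrite (leq_ltn_trans (size_polyD _ _)) // gtn_max size_polyN.
rewrite (leq_ltn_trans (size_scale_leq _ _)) ?size_polyX //=.
by rewrite (leq_ltn_trans (size_polyC_leq1 _)).
Qed.

Lemma monic_quadratic : quadratic \is monic.
Proof.
apply/monicP; rewrite lead_coefE size_quadratic /quadratic.
by rewrite !coefE /= mulr0 subr0 addr0.
Qed.

Lemma principal_quadratic_small (r : {poly D}) :
  (size r < 3)%N -> r \in principal quadratic -> r = 0.
Proof.
move=> rs /principalP[h rE]; have [h0|h0] := eqVneq h 0; first by rewrite rE h0 mul0r.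
move: rs; rewrite rE size_Mmonic ?monic_quadratic // size_quadratic addnS addnS /=.
by rewrite addn1 ltnS ltnS ltnS leqn0 size_poly_eq0 (negPf h0).
Qed.

(** If f * g is in the ideal, so is the product of the norms of the remainders
    of f and g; that product is a constant, hence 0, so one of the two norms
    is 0 and by anisotropy the corresponding remainder is 0. *)
Lemma prime_quadratic : prime_ideal (principal quadratic).
Proof.
have n1 : 1 \notin principal quadratic.
  apply/negP => /principal_quadratic_small; rewrite size_poly1 => /(_ isT)/eqP.
  by rewrite oner_eq0.
split; first exact: principal_idealr_closed.
have [_ _ idl] := principal_idealr_closed n1.
move=> f g fgI.
have red (h : {poly D}) : exists u v d, h = u%:P + v *: 'X + d * quadratic.
  pose r := Pdiv.Ring.rmodp h quadratic.
  exists r`_0, r`_1, (Pdiv.Ring.rdivp h quadratic).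
  rewrite addrC {1}[h](Pdiv.RingMonic.rdivp_eq monic_quadratic); congr (_ + _).
  have rs : (size r < 3)%N.
    by rewrite -size_quadratic Pdiv.Ring.ltn_rmodpN0 ?monic_neq0 ?monic_quadratic.
  apply/polyP => -[|[|i]]; rewrite !coefE /= ?mulr0 ?mulr1 ?addr0 ?add0r //.
  by rewrite nth_default // -ltnS (leq_trans rs).
have [u [v [d fE]]] := red f; have [u' [v' [d' gE]]] := red g.
pose N (x y : D) := x ^+ 2 + P * x * y + Q * y ^+ 2.
(* The conjugate of x + y X is x + y (P - X). *)
have conjE (x y : D) : exists k, (N x y)%:P =
    ((x + y * P)%:P - y *: 'X) * (x%:P + y *: 'X) + k * quadratic.
  exists (y ^+ 2)%:P; rewrite /N /quadratic -!mul_polyC !(rmorphD, rmorphXn, rmorphM) /=.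
  by ring.
have NI : (N u v * N u' v')%:P \in principal quadratic.
  have [k kE] := conjE u v; have [k' k'E] := conjE u' v'.
  rewrite polyCM kE k'E.
  set c := _ - _; set c' := _%:P - v' *: _; set l := u%:P + _; set l' := u'%:P + _.
  have -> : (c * l + k * quadratic) * (c' * l' + k' * quadratic) =
      (c * c') * (f * g) + (- (c * c') * (d * l' + d' * f) + c * l * k'
                            + k * c' * l' + k * k' * quadratic) * quadratic.
    by rewrite fE gE -/l -/l'; ring.
  exact/idl/principalMl.
have : N u v * N u' v' = 0.
  apply: polyC_inj; apply: principal_quadratic_small NI.
  exact: leq_ltn_trans (size_polyC_leq1 _) _.
have Ieq0 (x y : D) e :
    N x y = 0 -> x%:P + y *: 'X + e * quadratic \in principal quadratic.
  move=> N0; have y0 := norm_aniso N0; move: N0.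
  rewrite /N y0 expr0n /= !mulr0 !addr0 => /eqP; rewrite expf_eq0 /= => /eqP ->.
  by rewrite scale0r !add0r principalMl.
by move=> /eqP; rewrite mulf_eq0 => /orP[] /eqP N0; apply/orP;
  [left; rewrite fE|right; rewrite gE]; apply: Ieq0.
Qed.

End Quadratic.

(** * Polynomials in three variables as iterated univariate polynomials *)

Section Iterated.
Variable C : comNzRingType.

(** The variables of index 0, 1, 2 become the innermost, the middle and the
    outermost variable. *)
Definition iter_var (i : 'I_3) : {poly {poly {poly C}}} :=
  [:: 'X%:P%:P; 'X%:P; 'X]`_i.

Definition to_iter : {mpoly C[3]} -> {poly {poly {poly C}}} :=
  mmap (polyC \o polyC \o polyC) iter_var.

HB.instance Definition _ := GRing.RMorphism.on to_iter.

Let of_iter1 := horner_morph (fun c : C => mulrC 'X_(@Ordinal 3 0 isT) c%:MP).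
Let of_iter2 :=
  horner_morph (fun p : {poly C} => mulrC 'X_(@Ordinal 3 1 isT) (of_iter1 p)).
Definition of_iter : {poly {poly {poly C}}} -> {mpoly C[3]} :=
  horner_morph (fun p : {poly {poly C}} => mulrC 'X_(@Ordinal 3 2 isT) (of_iter2 p)).

HB.instance Definition _ := GRing.RMorphism.on of_iter.

Lemma of_iterC c : of_iter c%:P%:P%:P = c%:MP.
Proof. by do 3!rewrite [LHS]horner_morphC /=. Qed.

Lemma of_iter_var i : of_iter (iter_var i) = 'X_i.
Proof.
case: i => [[|[|[|i]]] hi] //;
  rewrite /iter_var (bool_irrelevance hi isT) /=.
- by do 2!rewrite [LHS]horner_morphC /=; rewrite [LHS]horner_morphX.
- by rewrite [LHS]horner_morphC /= [LHS]horner_morphX.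
- by rewrite [LHS]horner_morphX.
Qed.

Lemma to_iterK : cancel to_iter of_iter.
Proof.
move=> f; rewrite [RHS]mpolyE /to_iter /mmap rmorph_sum; apply: eq_bigr => m _.
rewrite rmorphM /= of_iterC mul_mpolyC mpolyXE_id; congr (_ *: _).
rewrite /mmap1 rmorph_prod; apply: eq_bigr => i _.
by rewrite rmorphXn /= of_iter_var.
Qed.

End Iterated.

(** * Primality of the boundary equation *)

(** The leading coefficients satisfy lead(w)^2 = lead(delta) * lead(v)^2, so for
    v nonzero the order of vanishing at a would be even on the left and odd on
    the right. *)
Lemma square_odd_mup (C : fieldType) (a : C) (delta w v : {poly {poly C}}) :
  delta != 0 -> odd (mup a (lead_coef delta)) -> w ^+ 2 = delta * v ^+ 2 -> v = 0.
Proof.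
move=> d0 od e; apply/eqP; apply: contraT => v0.
have w0 : w != 0.
  have : w ^+ 2 != 0 by rewrite e mulf_neq0 // expf_neq0.
  by rewrite expf_eq0.
have := congr1 (fun p => odd (mup a (lead_coef p))) e.
rewrite /= !expr2 !lead_coefM !mupM ?mulf_neq0 ?lead_coef_eq0 //.
by rewrite !oddD od !addbb.
Qed.

Section Torus.
Variables (C : fieldType) (b : C).
Hypothesis two_neq0 : 2 != 0 :> C.

Notation M_poly := (boundary_trace C - b%:MP).

Let P : {poly {poly C}} := 'X%:P * 'X.
Let Q : {poly {poly C}} := 'X%:P ^+ 2 + 'X ^+ 2 - 2 - b%:P%:P.

(** Used both for evaluations at points and for [to_iter]. *)
Lemma rmorph_M_poly (B : comNzRingType) (h : {rmorphism {mpoly C[3]} -> B}) :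
  h M_poly = - 2 + h (x1 C) ^+ 2 + h (x2 C) ^+ 2 + h (x3 C) ^+ 2
             - h (x1 C) * h (x2 C) * h (x3 C) - h b%:MP.
Proof.
(* The variables are generalized to keep unification from unfolding them. *)
rewrite /boundary_trace; move: (x1 C) (x2 C) (x3 C) b%:MP => X Y Z c.
by rewrite 2!rmorphB 3!rmorphD rmorphN rmorph_nat !rmorphXn 2!rmorphM.
Qed.

Lemma to_iter_M_poly : to_iter M_poly = quadratic P Q.
Proof.
have h i : to_iter 'X_i = iter_var C i by rewrite /to_iter mmapX mmap1U.
rewrite rmorph_M_poly /= /x1 /x2 /x3 !h /to_iter mmapC /iter_var /= /quadratic /P /Q.
rewrite -mul_polyC 2!polyCB polyCD polyCM !polyC_exp. 
ring.
Qed.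

(** The leading coefficient of the discriminant is x_1^2 - 4, which has a simple
    root at 2 in characteristic other than 2. *)
Lemma disc_odd :
  let delta := P ^+ 2 - 4 * Q in delta != 0 /\ odd (mup 2 (lead_coef delta)).
Proof.
move=> delta; pose c : {poly C} := ('X - 2%:P) * ('X + 2%:P).
have cl : size ('X + 2%:P : {poly C}) = 2%N by rewrite size_XaddC.
have c0 : c != 0 by rewrite mulf_neq0 ?polyXsubC_eq0 // -size_poly_eq0 cl.
have dE : delta = c *: 'X^2 + (- 4 * 'X^2 + (8 + 4 * b%:P))%:P.
  rewrite /delta /P /Q /c -mul_polyC.
  ring.
have dl : lead_coef delta = c.
  rewrite dE lead_coefDl ?lead_coefZ ?lead_coefXn ?mulr1 //.
  by rewrite size_scale // size_polyXn (leq_ltn_trans (size_polyC_leq1 _)).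
split; first by rewrite -lead_coef_eq0 dl.
rewrite dl mupMl; first by rewrite -['X - _]expr1 mup_XsubCX eqxx.
rewrite rootE hornerD hornerX hornerC.
have -> : 2 + 2 = 2 * 2 :> C by ring.
by rewrite mulf_neq0.
Qed.

Lemma torus_norm_aniso (u v : {poly {poly C}}) :
  u ^+ 2 + P * u * v + Q * v ^+ 2 = 0 -> v = 0.
Proof.
move=> N0; have [d0 od] := disc_odd.
apply: (square_odd_mup (w := 2 * u + P * v) d0 od).
apply/eqP; rewrite -subr_eq0; apply/eqP.
(* Completing the square: 4 N = (2 u + P v)^2 - (P^2 - 4 Q) v^2. *)
transitivity (4 * (u ^+ 2 + P * u * v + Q * v ^+ 2)); first by ring.
by rewrite N0 mulr0.
Qed.

Lemma prime_M_poly : prime_ideal (principal M_poly).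
Proof.
apply: (prime_principal_retract (@to_iterK C)).
by rewrite /= to_iter_M_poly; exact: prime_quadratic torus_norm_aniso.
Qed.

Lemma M_poly_neq0 : M_poly != 0.
Proof.
apply/eqP => /(congr1 (@to_iter C)); rewrite to_iter_M_poly rmorph0.
by apply/eqP; rewrite monic_neq0 // monic_quadratic.
Qed.

Lemma has_codim_M_eqn : has_codim (ideal_gen (M_eqn b)) 1.
Proof. exact: has_codim_principal_prime M_poly_neq0 prime_M_poly. Qed.

Lemma smooth_M_eqn :
  smooth_Spec (M_eqn b) <-> forall f, jacobian_ideal (M_eqn b) 1 f.
Proof.
split=> [/(_ _ has_codim_M_eqn)//|sm c /(has_codim_unique has_codim_M_eqn) <-].
exact: sm.
Qed.

End Torus.

(** * The Jacobian ideal *)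

Lemma mem_jacobian1 (C : fieldType) (n : nat) (p f : {mpoly C[n]}) :
  (f \in [tuple p] ++ jacobian_minors [tuple p] 1) =
  (f == p) || [exists j, f == p^`M(j)].
Proof.
rewrite mem_cat inE; congr (_ || _); apply/allpairsP/existsP => /=.
  move=> [[r s] /= [_ _ ->]]; exists (s ord0).
  by rewrite det_mx11 !mxE [r _]ord1.
move=> [j /eqP ->]; exists ([ffun=> ord0], [ffun=> j]); rewrite !mem_enum; split=> //.
by rewrite det_mx11 !mxE !ffunE.
Qed.

Section TorusJacobian.
Variables (C : fieldType) (b : C).
Notation M_poly := (boundary_trace C - b%:MP).
Notation X := (x1 C).
Notation Y := (x2 C).
Notation Z := (x3 C).

Let i1 : 'I_3 := @Ordinal 3 0 isT.
Let i2 : 'I_3 := @Ordinal 3 1 isT.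
Let i3 : 'I_3 := @Ordinal 3 2 isT.

Lemma mderiv_M_poly j : M_poly^`M(j) =
  2 * X * X^`M(j) + 2 * Y * Y^`M(j) + 2 * Z * Z^`M(j)
  - (X^`M(j) * Y * Z + X * Y^`M(j) * Z + X * Y * Z^`M(j)).
Proof.
rewrite mderivB mderivC /boundary_trace; move: X Y Z => u v w.
rewrite mderivB 3!mderivD mderivN mderivMn mderivC !expr2 !mderivM.
ring.
Qed.

Lemma mderivXU j i : ('X_i : {mpoly C[3]})^`M(j) = (i == j)%:R.
Proof.
rewrite mderivX mnm1E; case: eqP => [->|_]; last by rewrite scale0r.
have -> : (U_(j) - U_(j) = 0)%MM by apply/mnmP => k; rewrite mnmBE mnm0E subnn.
by rewrite mpolyX0 scale1r.
Qed.

Lemma grad_M_poly :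
  [/\ M_poly^`M(i1) = 2 * X - Y * Z, M_poly^`M(i2) = 2 * Y - X * Z
    & M_poly^`M(i3) = 2 * Z - X * Y].
Proof. by split; rewrite mderiv_M_poly !mderivXU /=; ring. Qed.

(** Put s = b + 2, let e_i = x_i dg/dx_i and k = 2 g - (e_1 + e_2 + e_3).  Then
    x_1 x_2 x_3 = 2 s + k and 2 x_i^2 = 2 s + h_i with h_i = k + e_i, where the
    e_i, k and h_i lie in the Jacobian ideal.  The identity
    (2 s + h_1) (2 s + h_2) (2 s + h_3) = 8 (2 s + k)^2 has constant term
    8 s^3 - 32 s^2 = 8 (b + 2)^2 (b - 2). *)
Lemma jacobian_M_eqn_disc :
  jacobian_ideal (M_eqn b) 1 (8 * ((b + 2) ^+ 2 * (b - 2)))%:MP.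
Proof.
have [d1 d2 d3] := grad_M_poly.
pose J := jacobian_ideal (M_eqn b) 1.
have JD f g : J f -> J g -> J (f + g) by exact: ideal_genD.
have JM a f : J f -> J (a * f) by exact: ideal_genM.
have JN f : J f -> J (- f) by rewrite -mulN1r; exact: JM.
have Jg : J M_poly by apply: mem_ideal_gen; rewrite mem_jacobian1 eqxx.
have Jd j : J M_poly^`M(j).
  apply: mem_ideal_gen; rewrite mem_jacobian1; apply/orP; right.
  by apply/existsP; exists j.
pose e1 := X * (2 * X - Y * Z); pose e2 := Y * (2 * Y - X * Z).
pose e3 := Z * (2 * Z - X * Y).
have J1 : J e1 by apply: JM; rewrite -d1.
have J2 : J e2 by apply: JM; rewrite -d2.
have J3 : J e3 by apply: JM; rewrite -d3.
pose k := 2 * M_poly - (e1 + e2 + e3).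
have Jk : J k by apply: (JD); [exact: JM|apply/JN/(JD)/J3/(JD)].
pose h1 := k + e1; pose h2 := k + e2; pose h3 := k + e3.
pose s : {mpoly C[3]} := (b + 2)%:MP.
have -> : (8 * ((b + 2) ^+ 2 * (b - 2)))%:MP =
   (32 * s + 8 * k) * k - (4 * s ^+ 2 + 2 * s * h2 + 2 * s * h3 + h2 * h3) * h1
   - (4 * s ^+ 2 + 2 * s * h3) * h2 - 4 * s ^+ 2 * h3.
  rewrite /h1 /h2 /h3 /k /s /e1 /e2 /e3 /boundary_trace; move: X Y Z => u v w.
  ring.
have [Jh1 Jh2 Jh3] : [/\ J h1, J h2 & J h3] by split; apply: (JD).
by do 3!(apply: (JD); last exact/JN/JM); apply: JM.
Qed.

Lemma singular_point (v : 'I_3 -> C) :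
  M_poly.@[v] = 0 -> (forall j, M_poly^`M(j).@[v] = 0) ->
  ~ (forall f, jacobian_ideal (M_eqn b) 1 f).
Proof.
move=> v0 dv0 /(_ 1) J1.
have : meval v 1 = 0.
  apply: ideal_gen_rmorph J1 => g; rewrite mem_jacobian1.
  by case/orP => [/eqP ->|/existsP[j /eqP ->]] //; apply: dv0.
by rewrite meval1 => /eqP; rewrite oner_eq0.
Qed.

End TorusJacobian.

Lemma jacobian_M_eqn_unit (C : fieldType) (b : C) :
  2 != 0 :> C -> b + 2 != 0 -> b - 2 != 0 ->
  forall f, jacobian_ideal (M_eqn b) 1 f.
Proof.
move=> two0 bp bm f.
have c0 : 8 * ((b + 2) ^+ 2 * (b - 2)) != 0.
  have -> : 8 = 2 ^+ 3 :> C by ring.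
  by rewrite !mulf_neq0 ?expf_neq0.
rewrite -[f]mulr1 -mpolyC1 -[X in X%:MP](mulVf c0) mpolyCM mulrA.
exact/ideal_genM/jacobian_M_eqn_disc.
Qed.

(** The polynomial t takes the value -2 + 3 x^2 - x^3 at (x, x, x), and each
    partial derivative takes the value 2 x - x^2 there. *)
Lemma jacobian_M_eqn_diag (C : fieldType) (b x : C) :
  - 2 + 3 * x ^+ 2 - x ^+ 3 = b -> 2 * x - x ^+ 2 = 0 ->
  ~ (forall f, jacobian_ideal (M_eqn b) 1 f).
Proof.
move=> tb dx; have [g1 g2 g3] := grad_M_poly b.
apply: (@singular_point _ _ (fun=> x)).
  by rewrite rmorph_M_poly /= mevalC !mevalXU -tb; ring.
have dE u v w : u.@[fun=> x] = x -> v.@[fun=> x] = x -> w.@[fun=> x] = x ->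
    (2 * u - v * w).@[fun=> x] = 0.
  by move=> eu ev ew; rewrite mevalB !mevalM eu ev ew -[2]mpolyC_nat mevalC -expr2.
case=> [[|[|[|j]]] hj] //; rewrite (bool_irrelevance hj isT) ?g1 ?g2 ?g3;
  apply: dE; exact: mevalXU.
Qed.

Theorem mainTheorem1 (R : realType) (b : R[i]) :
  singular_Spec (M_eqn b) <-> (psi1 R[i]).[b] = 0.
Proof.
have two0 : 2 != 0 :> R[i] by rewrite Num.Theory.pnatr_eq0.
have psiE : (psi1 R[i]).[b] = (b + 2) * (b - 2).
  by rewrite /psi1 hornerD hornerN hornerXn -polyC_natr hornerC; ring.
rewrite /singular_Spec (smooth_M_eqn b two0) psiE; split=> [sing|/eqP].
  apply/eqP; apply: contraT; rewrite mulf_eq0 negb_or => /andP[bp bm].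
  by case: sing; exact: jacobian_M_eqn_unit.
rewrite mulf_eq0 addr_eq0 subr_eq0 => /orP[] /eqP bE.
  by apply: (jacobian_M_eqn_diag (x := 0)); rewrite ?bE; ring.
by apply: (jacobian_M_eqn_diag (x := 2)); rewrite ?bE; ring.
Qed.
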